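(* Let $E$ be a Banach space, let $D \subset E^{\ast}$ be a weak$^\ast$-compact convex set with $0 \notin D$ and let $C \subset E^{\ast}$ be a weak$^\ast$-closed convex set such that every $x \in L_{D}$ has finite supremum on $C$. Given $B \subset C$, the following assertions are equivalent: (i) For every covering $B \subseteq \bigcup_{n =1}^{\infty}K_{n}$ by an increasing sequence of weak$^\ast$-compact convex subsets $K_{n} \subset C$ we have \[ C \subset \overline{\bigcup_{n=1}^{\infty}K_{n} + \Lambda_{D}}^{\| \cdot \|}. \] (ii) For every bounded sequence $(x_{n})_{n \in \mathbb{N}}$ in $L_{D}$, \[ \sup_{b^{\ast} \in B}\Big(\limsup_{n}\langle b^{\ast},x_{n} \rangle\Big) = \sup_{c^{\ast} \in C}\Big(\limsup_{n}\langle c^{\ast}, x_{n} \rangle\Big). \] (iii) For every bounded sequence $(x_{n})_{n \in \mathbb{N}}$ in $L_{D}$, \[ \sup_{b^{\ast} \in B}\Big(\limsup_{n}\langle b^{\ast},x_{n} \rangle\Big) \geq \inf_{x \in \operatorname{co}_{\sigma_{p}}\{ x_{n} : n \geq 1 \}}\ \sup_{c^{\ast} \in C}\langle c^{\ast}, x\rangle . \]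
   Context: Banach spaces are real. For $D \subset E^\ast$: if $D\neq\emptyset$, $L_D := \{x \in E : \sup_{d^\ast\in D}\langle x,d^\ast\rangle < 0\}$; if $D = \emptyset$, $L_\emptyset := E\setminus\{0\}$. $\Lambda_D := \{0\}\cup\{\lambda d^\ast : \lambda>0,\ d^\ast\in D\}$. $\overline{S}^{\|\cdot\|}$ is the norm closure of $S$ in $E^\ast$. For a bounded sequence $(x_n)$ in $E$, \[ \operatorname{co}_{\sigma_{p}}\{ x_{n} : n \geq 1 \} := \Big\{ \sum_{n=1}^{\infty}\lambda_{n} x_{n} : \lambda_{n} \geq 0 \text{ for all } n \geq 1,\ \sum_{n=1}^{\infty}\lambda_{n} = 1 \Big\}. \]
   Formalization: The case E = {0} with B empty is excluded, since there the equivalence fails: for D = B = ∅ and C = {0}, (ii) and (iii) hold vacuously while (i) fails for K_n = ∅. *)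

(* Defs.v *)
From HB Require Import structures.
From mathcomp Require Import all_boot all_order all_algebra.
From mathcomp Require Import ring.
From mathcomp Require Import all_classical all_reals all_analysis.

Set Implicit Arguments.
Unset Strict Implicit.
Unset Printing Implicit Defensive.

Import Order.TTheory GRing.Theory Num.Theory.
Import numFieldNormedType.Exports.

Local Open Scope classical_set_scope.
Local Open Scope ring_scope.

Section dual.
Context {R : realType} (E : normedModType R).

Definition dual_pred : {pred E -> R^o} :=
  fun f => `[< linear f /\ continuous f >].

Record dual := Dual {
  dual_fun :> E -> R^o;
  dual_funP : dual_fun \in dual_pred }.

HB.instance Definition _ := [isSub for dual_fun].
HB.instance Definition _ := [Choice of dual by <:].

Lemma dual_submod_closed : submod_closed dual_pred.
Proof.
split; first by apply/asboolP; split => [a x y|x]; [rewrite /= scaler0 addr0|exact: cvg_cst].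
move=> a f g /asboolP[lf cf] /asboolP[lg cg]; apply/asboolP; split.
  move=> b x y; rewrite !fctE /= lf lg /GRing.scale /=; ring.
by move=> x; apply: cvgD; [apply: cvgZr; exact: cf|exact: cg].
Qed.

HB.instance Definition _ := GRing.isSubmodClosed.Build _ _ dual_pred
  dual_submod_closed.
HB.instance Definition _ := [SubChoice_isSubLmodule of dual by <:].

Definition dual_norm (f : dual) : R := sup [set `|f x| | x in [set x | `|x| <= 1]].

Lemma dual_linear (f : dual) : linear f.
Proof. by case: f => f /= /asboolP[]. Qed.

Lemma dual_continuous (f : dual) : continuous f.
Proof. by case: f => f /= /asboolP[]. Qed.

HB.instance Definition _ (f : dual) :=
  GRing.isLinear.Build R E R^o _ f (dual_linear f).

Lemma dual_norm_has_sup (f : dual) :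
  has_sup [set `|f x| | x in [set x | `|x| <= 1]].
Proof.
split; first by exists `|f 0|, 0 => //=; rewrite normr0.
have /linear_boundedP/pinfty_ex_gt0[r r0 rf] :
    bounded_near f (nbhs (0 : E)).
  by apply/linear_bounded_continuous; exact: dual_continuous.
exists r => _ [x /= x1 <-]; rewrite (le_trans (rf x))//.
by rewrite -[leRHS]mulr1 ler_wpM2l// ltW.
Qed.

Lemma dual_norm_ub (f : dual) x : `|x| <= 1 -> `|f x| <= dual_norm f.
Proof.
move=> x1; apply: ub_le_sup; last by exists x.
by case: (dual_norm_has_sup f).
Qed.

Lemma dual_norm_le (f : dual) c :
  (forall x, `|x| <= 1 -> `|f x| <= c) -> dual_norm f <= c.
Proof.
move=> fc; apply: ge_sup; first by case: (dual_norm_has_sup f).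
by move=> _ [x /= x1 <-]; exact: fc.
Qed.

Lemma ler_dual_normD (f g : dual) :
  dual_norm (f + g) <= dual_norm f + dual_norm g.
Proof.
apply: dual_norm_le => x x1.
by rewrite (le_trans (ler_normD (f x) (g x)))// lerD// dual_norm_ub.
Qed.

Lemma dual_normZ (l : R) (f : dual) : dual_norm (l *: f) = `|l| * dual_norm f.
Proof.
have le k (g : dual) : dual_norm (k *: g) <= `|k| * dual_norm g.
  apply: dual_norm_le => x x1.
  by rewrite [X in X <= _](normrM k (g x)) ler_wpM2l// dual_norm_ub.
apply/eqP; rewrite eq_le le /=.
have [->|l0] := eqVneq l 0.
  rewrite normr0 mul0r; apply: (le_trans (normr_ge0 ((0 *: f : dual) 0))).
  by apply: dual_norm_ub; rewrite normr0.
rewrite -ler_pdivlMl ?normr_gt0// -normfV.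
by rewrite -{1}[f](scalerK l0) le.
Qed.

Lemma dual_norm0_eq0 (f : dual) : dual_norm f = 0 -> f = 0.
Proof.
move=> f0; apply/val_inj/funext => x /=.
have [->|x0] := eqVneq x 0; first by rewrite linear0.
have : `|f (`|x|^-1 *: x)| <= 0.
  rewrite -f0; apply: dual_norm_ub.
  by rewrite normrZ normfV normr_id mulVf ?normr_eq0.
rewrite linearZ/= normr_le0 => /eqP/(congr1 (fun y => `|x| * y)).
by rewrite mulr0 /GRing.scale/= mulVKf ?normr_eq0.
Qed.

HB.instance Definition _ :=
  Lmodule_isNormed.Build R dual ler_dual_normD dual_normZ dual_norm0_eq0.

(* The library topology of [dual] is that of the norm; [weakstar] is the same
   set of functionals with the topology of pointwise convergence on E. *)
Definition weakstar : Type := dual.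

HB.instance Definition _ := Choice.on weakstar.
HB.instance Definition _ := Topological.copy weakstar
  (initial_topology (fun f : dual => (f : E -> R^o) : {ptws E -> R^o})).

Definition weakstar_compact (K : set dual) := compact (K : set weakstar).

Definition weakstar_closed (K : set dual) := closed (K : set weakstar).

(* The supremum is -oo when D is empty. *)
Definition supremum_on (D : set dual) (x : E) : \bar R :=
  ereal_sup [set (d x)%:E | d in D].

Definition negative_domain (D : set dual) : set E :=
  if D == set0 then ~` [set 0] else [set x | (supremum_on D x < 0)%E].

Definition generated_cone (D : set dual) : set dual :=
  [set 0] `|` [set l *: d | l in [set l : R | 0 < l] & d in D].

Definition set_add (A B : set dual) : set dual :=
  [set a + b | a in A & b in B].

Definition sigma_convex_hull (x : nat -> E) : set E :=
  [set y | exists l : nat -> R, [/\ forall n, 0 <= l n,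
    series l @ \oo --> (1 : R) &
    series (fun n => l n *: x n) @ \oo --> y]].

End dual.

(* Main.v *)
Require Import Defs.
From HB Require Import structures.
From mathcomp Require Import all_boot all_order all_algebra.
From mathcomp Require Import ring lra finmap.
From mathcomp Require Import all_classical all_reals all_analysis.

Set Implicit Arguments.
Unset Strict Implicit.
Unset Printing Implicit Defensive.

Import Order.TTheory GRing.Theory Num.Theory.
Import numFieldNormedType.Exports.

Local Open Scope classical_set_scope.
Local Open Scope ring_scope.

(** Write L for the set of negative directions of D, that is, [negative_domain D];
distances between functionals are those of the dual norm.

(i) => (ii).  Suppose that the limsup along a bounded sequence x in L stays below
a real number a on B.  The sets K_n of those c in C of norm at most n that
satisfy c (x_m) <= a for all m >= n are weak* compact, convex and increasing, and
they cover B.  Adding an element of the cone of D only lowers the values on L,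
and x is bounded, so every norm limit of elements of the union of the K_n plus
the cone also has limsup at most a along x; by (i) this applies to all of C
([limsup_sup_eq]).

(ii) => (iii).  It suffices that the supremum over C of the limsups dominates the
infimum v of the support function of C on the hull.  More is true: for every
a < v there is a single c in C with c (x_n) >= a for all n
([inf_sup_le_limsup]).  For finitely many n this is the theorem of the
alternative for finitely many affine functions on a convex set
([affine_alternative]): otherwise some convex combination of the x_n would have
support function at most a.  Compactness passes to all n, because a slice
{c in C | c (x_0) >= a} is weak* compact even when C is unbounded: L is open and
the support function of C is finite on L, so the slice is pointwise bounded,
hence bounded in norm by the uniform boundedness principle, and Banach-Alaoglu
applies ([weakstar_compact_upper_slice]).

(iii) => (i).  Suppose that c in C has distance at least delta > 0 from the union
of the K_n plus the cone of D.  For each n the same alternative, applied to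
K_n + [0, m] D and to the unit ball of E, gives a vector x of norm at most 1 with
k (x) + t d (x) <= c (x) - delta / 2 for all k in K_n, d in D and t in [0, m].
No extension theorem for functionals is involved, since the separating vector is
produced inside E from the start.  When m is large, d (x) is nearly nonpositive
on D, and a small multiple of a fixed element of L pushes x into L
([separating_direction]).  Along a subsequence c (y_n) converges to some t; on
the hull of a tail the support function of C is then at least about t, while each
b in B lies in K_n for large n and so has limsup at most about t - delta / 4.
This contradicts (iii) ([subset_closure_cone]). *)

(** * A theorem of the alternative for affine functions *)

Section convex_alternative.
Context {R : realType} {V : lmodType R}.
Implicit Types (A : set V) (f g h : V -> R).

Lemma convex_setP A : convex_set A <->
  forall x y (p q : R), A x -> A y -> 0 <= p -> 0 <= q -> p + q = 1 ->
    A (p *: x + q *: y).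
Proof.
split=> [cA x y p q Ax Ay p0 q0 pq|cA x y l xA yA].
  have p01 : 0 <= p <= 1 by rewrite p0 -pq lerDl q0.
  have qE : q = 1 - p by rewrite -pq addrC addKr.
  have /set_mem := cA x y (Itv01 (andP p01).1 (andP p01).2)
    (mem_set Ax) (mem_set Ay).
  by rewrite qE.
apply/mem_set; apply: (cA x y l%:num (1 - l%:num)).
- exact/set_mem.
- exact/set_mem.
- by [].
- by rewrite subr_ge0.
- by rewrite addrC subrK.
Qed.

Definition affine f := forall x y (p q : R), p + q = 1 ->
  f (p *: x + q *: y) = p * f x + q * f y.

(** In the plane of the pairs (g, h), the image of A avoids the open first
quadrant.  If h is positive somewhere on A, the weight of h relative to g is the
infimum of - g / h over the part of A where h is positive; it dominates g / - h wherever h is negative, because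
otherwise a segment joining two such points would cross the quadrant. *)
Lemma affine_alternative2 A g h : convex_set A -> affine g -> affine h ->
  (forall a, A a -> 0 < h a -> g a <= 0) ->
  exists p q : R, [/\ 0 <= p, 0 <= q, p + q = 1 &
    forall a, A a -> p * g a + q * h a <= 0].
Proof.
move=> /convex_setP cA affg affh gh.
have [[a0 [Aa0 ha0]]|nA] := pselect (exists a, A a /\ 0 < h a); last first.
  exists 0, 1; split => // [|a Aa]; first by rewrite add0r.
  rewrite mul0r add0r mul1r leNgt; apply/negP => ha.
  by apply: nA; exists a.
have cross a b : A a -> A b -> 0 < h a -> h b <= 0 -> g b * h a <= g a * h b.
  move=> Aa Ab ha hb; have ga := gh _ Aa ha.
  have [gb|gb] := ltP 0 (g b); last first.
    by rewrite (@le_trans _ _ 0)// ?mulr_le0_ge0 ?mulr_le0// ltW.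
  rewrite leNgt; apply/negP => gab.
  (* Along the segment from b to a, g vanishes where h takes the positive value
     2 * r.  The point where h equals r lies on the side of b, so that g is still
     positive there. *)
  have [e [e0 e1 ew he]] : exists e : R, [/\ 0 <= e, e <= 1,
      0 < e * g a + (1 - e) * g b & 0 < e * h a + (1 - e) * h b].
    pose r := (g b * h a - g a * h b) / (2 * (g b - g a)).
    have gba : 0 < g b - g a by lra.
    have r0 : 0 < r by rewrite divr_gt0 ?subr_gt0 ?mulr_gt0.
    have rE : 2 * (g b - g a) * r = g b * h a - g a * h b.
      by rewrite /r mulrC divfK// mulf_neq0 ?gt_eqF.
    have hab : 0 < h a - h b by lra.
    have rha : r < h a by rewrite /r ltr_pdivrMr ?mulr_gt0//; nra.
    exists ((r - h b) / (h a - h b)).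
    have eE : (r - h b) / (h a - h b) * (h a - h b) = r - h b.
      by rewrite divfK ?gt_eqF.
    set e := (r - h b) / _ in eE *.
    have e1 : e <= 1 by rewrite /e ler_pdivrMr// mul1r; lra.
    split => //.
    - by apply: divr_ge0; lra.
    - rewrite -(pmulr_lgt0 _ hab).
      have -> : (e * g a + (1 - e) * g b) * (h a - h b) =
         g a * (e * (h a - h b)) + g b * (h a - h b) - g b * (e * (h a - h b)).
        by ring.
      rewrite eE; lra.
    - have -> : e * h a + (1 - e) * h b = e * (h a - h b) + h b by ring.
      rewrite eE; lra.
  have e11 : e + (1 - e) = 1 by rewrite addrC subrK.
  have : g (e *: a + (1 - e) *: b) <= 0.
    by apply: gh; [apply: cA; rewrite ?subr_ge0|rewrite affh].
  by rewrite affg// leNgt ew.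
pose T := [set - g a / h a | a in [set a | A a /\ 0 < h a]].
have Tlb : lbound T 0.
  move=> _ [a [Aa ha] <-].
  by apply: divr_ge0; [rewrite oppr_ge0 gh|exact: ltW].
have T0 : T !=set0 by exists (- g a0 / h a0), a0.
pose t := inf T.
have t0 : 0 <= t by exact: lb_le_inf.
have gth a : A a -> g a + t * h a <= 0.
  move=> Aa; have [ha|ha] := ltP 0 (h a).
    have : t <= - g a / h a by apply: ge_inf; [exists 0|exists a].
    by rewrite ler_pdivlMr//; lra.
  move: ha; rewrite le_eqVlt => /orP[/eqP ha|ha].
    have := cross a0 a Aa0 Aa ha0; rewrite ha mulr0 => /(_ (lexx _)).
    by rewrite mulr0 addr0 pmulr_lle0.
  suff : g a / - h a <= t by rewrite ler_pdivrMr ?oppr_gt0//; lra.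
  apply: lb_le_inf => // _ [b [Ab hb] <-].
  have nha : 0 < - h a by rewrite oppr_gt0.
  rewrite ler_pdivrMr// mulrAC ler_pdivlMr//.
  by rewrite mulrNN cross// ltW.
have t1 : 0 < 1 + t by lra.
exists (1 + t)^-1, (t / (1 + t)); split.
- by rewrite invr_ge0 ltW.
- by rewrite divr_ge0// ltW.
- by rewrite -{1}(mul1r (_^-1)) -mulrDl divff ?gt_eqF.
- move=> a Aa; rewrite [X in X <= _](_ : _ = (g a + t * h a) / (1 + t)).
    by rewrite ler_pdivrMr// mul0r gth.
  by ring.
Qed.

(** Induction on s: the induction hypothesis is used on the part of A where the
new function is positive, which merges all the other functions into one, and two
functions remain. *)
Lemma affine_alternative (I : eqType) (f : I -> V -> R) (s : seq I) A :
  convex_set A -> (forall i, affine (f i)) -> uniq s -> s != [::] ->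
  (forall a, A a -> exists2 i, i \in s & f i a <= 0) ->
  exists l : I -> R, [/\ forall i, 0 <= l i, \sum_(i <- s) l i = 1 &
    forall a, A a -> \sum_(i <- s) l i * f i a <= 0].
Proof.
move=> + afff; elim: s A => // i s IH A cA /= /andP[iNs us] _ fA.
have [sE|s0] := eqVneq s [::].
  subst s; exists (fun=> 1); split => // [|a /fA].
    by rewrite big_seq1.
  by rewrite big_seq1 mul1r => -[j]; rewrite mem_seq1 => /eqP->.
pose A' := A `&` [set a | 0 < f i a].
have cA' : convex_set A'.
  apply/convex_setP => x y p q [Ax fx] [Ay fy] p0 q0 pq; split.
    by move/convex_setP : cA; exact.
  rewrite /= afff//; have [pE|p1] := eqVneq p 0.
    by rewrite pE mul0r add0r mulr_gt0//; lra.
  by rewrite ltr_pwDl// ?mulr_gt0 ?mulr_ge0// ?ltW// lt_neqAle eq_sym p1.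
have [a [Aa fa]|l [l0 l1 lA']] := IH _ cA' us s0.
  have [j] := fA _ Aa; rewrite inE => /orP[/eqP->|js fj]; last by exists j.
  by rewrite leNgt fa.
have affg : affine (fun a => \sum_(j <- s) l j * f j a).
  move=> x y p q pq; rewrite !mulr_sumr -big_split/=.
  by apply: eq_bigr => j _; rewrite afff//; ring.
have [//|p [q [p0 q0 pq pqA]]] := affine_alternative2 cA affg (afff i).
  by move=> a Aa fa; exact: lA'.
exists (fun j => if j == i then q else p * l j).
have sE F : \sum_(j <- s) (if j == i then q else p * l j) * F j =
    p * \sum_(j <- s) l j * F j.
  rewrite mulr_sumr; apply: eq_big_seq => j js.
  by rewrite ifN ?mulrA//; apply: contraNneq iNs => <-.
split => [j||a Aa].
- by case: ifP => // _; rewrite mulr_ge0.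
- rewrite big_cons eqxx -[X in _ + X]mulr1 mulr_suml (sE (fun=> 1)).
  by rewrite -mulr_suml l1 !mulr1 addrC.
- by rewrite big_cons eqxx sE addrC pqA.
Qed.

End convex_alternative.

(** * The weak* topology *)

HB.instance Definition _ (R : realType) (E : normedModType R) :=
  isPointed.Build (weakstar E) (0 : dual E).

Section weakstar_topology.
Context {R : realType} {E : normedModType R}.
Implicit Types (f g : dual E) (K L S : set (dual E)).

Lemma dualDE f g x : (f + g) x = f x + g x. Proof. by []. Qed.

Lemma dualZE (a : R) f x : (a *: f) x = a * f x. Proof. by []. Qed.

Lemma dualBE f g x : (f - g) x = f x - g x. Proof. by []. Qed.

Lemma dual_appD f x y : f (x + y) = f x + f y.
Proof. exact: linearD. Qed.

Lemma dual_appN f x : f (- x) = - f x.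
Proof. exact: linearN. Qed.

Lemma dual_appZ f (a : R) x : f (a *: x) = a * f x.
Proof. exact: linearZ. Qed.

Lemma dualP f g : (forall x, f x = g x) -> f = g.
Proof. by move=> fg; apply/val_inj/funext. Qed.

Lemma dual_le_norm f x : `|f x| <= `|f| * `|x|.
Proof.
have [->|x0] := eqVneq x 0; first by rewrite linear0 !normr0 mulr0.
have : `|f (`|x|^-1 *: x)| <= `|f|.
  by apply: dual_norm_ub; rewrite normrZ normfV normr_id mulVf ?normr_eq0.
by rewrite linearZ/= normrZ normfV normr_id mulrC ler_pdivrMr ?normr_gt0.
Qed.

Lemma weakstar_cvgP (F : set_system (weakstar E)) (f : weakstar E) :
  Filter F ->
  F --> f <->
  forall x, (fun g : weakstar E => (g : dual E) x) @ F --> (f : dual E) x.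
Proof.
move=> FF; split=> [Ff x|Ff].
  have : ((fun g : weakstar E => (g : E -> R^o) : {ptws E -> R^o}) @ F)
      --> (((f : dual E) : E -> R^o) : {ptws E -> R^o}).
    apply: cvg_trans; last exact: initial_continuous.
    exact: cvg_app.
  by move/(pointwise_cvgP _ _).1; apply.
move=> A [_ [[B oB <-] Bf BA]].
apply: filterS BA _.
have /(_ B) : {ptws, ((fun g : weakstar E => (g : E -> R^o)) @ F) -->
    ((f : dual E) : E -> R^o)} by apply/pointwise_cvgP => x; exact: Ff.
by apply; exact: open_nbhs_nbhs.
Qed.

Lemma weakstar_eval_continuous x :
  continuous (fun f : weakstar E => (f : dual E) x : R).
Proof. by move=> f; have /weakstar_cvgP : nbhs f --> f by []; apply. Qed.

Lemma weakstar_closed_ge x (a : R) : weakstar_closed [set f : dual E | a <= f x].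
Proof.
apply: (@closed_comp _ _ (fun f : weakstar E => (f : dual E) x : R)
  [set t | a <= t]).
  by move=> f _; exact: weakstar_eval_continuous.
exact: closed_ge.
Qed.

Lemma weakstar_closed_le x (a : R) : weakstar_closed [set f : dual E | f x <= a].
Proof.
apply: (@closed_comp _ _ (fun f : weakstar E => (f : dual E) x : R)
  [set t | t <= a]).
  by move=> f _; exact: weakstar_eval_continuous.
exact: closed_le.
Qed.

Lemma weakstar_compact_slice K x a :
  weakstar_compact K -> weakstar_compact (K `&` [set f : dual E | a <= f x]).
Proof. by move=> cK; apply: compact_closedI => //; exact: weakstar_closed_ge. Qed.

Lemma weakstar_compact_add K L :
  weakstar_compact K -> weakstar_compact L -> weakstar_compact (set_add K L).
Proof.
move=> cK cL.
have -> : set_add K L =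
    (fun p : weakstar E * weakstar E =>
       (p.1 : dual E) + (p.2 : dual E) : weakstar E) @` (K `*` L).
  apply/seteqP; split=> [_ [k Kk [l Ll <-]]|_ [[k l] [/= Kk Ll] <-]].
    by exists (k, l).
  by exists k => //; exists l.
apply: (@continuous_compact (weakstar E * weakstar E)%type (weakstar E)); last first.
  exact: (@compact_setX (weakstar E) (weakstar E) _ _ cK cL).
apply: continuous_subspaceT => -[k l].
apply/weakstar_cvgP => x.
apply: (@cvgD _ R^o _ (nbhs (k, l)) _
  (fun p : weakstar E * weakstar E => (p.1 : dual E) x)
  (fun p : weakstar E * weakstar E => (p.2 : dual E) x)).
- apply: (@cvg_comp _ _ _ fst (fun f : weakstar E => (f : dual E) x)
    (nbhs (k, l)) (nbhs k)).
    exact: cvg_fst.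
  exact: weakstar_eval_continuous.
- apply: (@cvg_comp _ _ _ snd (fun f : weakstar E => (f : dual E) x)
    (nbhs (k, l)) (nbhs l)).
    exact: cvg_snd.
  exact: weakstar_eval_continuous.
Qed.

(** The cone generated by K is not weak* compact in general; its truncations are,
and they exhaust it. *)
Definition truncated_cone (M : R) K : set (dual E) :=
  [set a *: k | a in [set a : R | 0 <= a <= M] & k in K].

Lemma weakstar_compact_truncated_cone M K :
  weakstar_compact K -> weakstar_compact (truncated_cone M K).
Proof.
move=> cK.
have -> : truncated_cone M K =
    (fun p : R * weakstar E => p.1 *: (p.2 : dual E) : weakstar E) @`
      (`[0, M]%classic `*` K).
  apply/seteqP; split=> [_ [a aM [k Kk <-]]|_ [[a k] [/= aM Kk] <-]].
    by exists (a, k) => //; split => //=; rewrite in_itv.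
  by exists a => //; exists k.
apply: (@continuous_compact (R * weakstar E)%type (weakstar E)); last first.
  by apply: (@compact_setX R (weakstar E)) => //; exact: segment_compact.
apply: continuous_subspaceT => -[a k].
apply/weakstar_cvgP => x.
apply: (@cvgM _ _ (nbhs (a, k)) _ (fun p : R * weakstar E => p.1)
  (fun p : R * weakstar E => (p.2 : dual E) x)).
- exact: cvg_fst.
- apply: (@cvg_comp _ _ _ snd (fun f : weakstar E => (f : dual E) x)
    (nbhs (a, k)) (nbhs k)).
    exact: cvg_snd.
  exact: weakstar_eval_continuous.
Qed.

Lemma convex_set_add K L :
  convex_set K -> convex_set L -> convex_set (set_add K L).
Proof.
move=> /convex_setP cK /convex_setP cL; apply/convex_setP.
move=> _ _ p q [k Kk [l Ll <-]] [k' Kk' [l' Ll' <-]] p0 q0 pq.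
exists (p *: k + q *: k'); first exact: cK.
exists (p *: l + q *: l'); first exact: cL.
by rewrite !scalerDr addrACA.
Qed.

Lemma convex_truncated_cone M K : convex_set K -> convex_set (truncated_cone M K).
Proof.
move=> /convex_setP cK; apply/convex_setP.
move=> _ _ p q [a /= /andP[a0 aM] [k Kk <-]] [b /= /andP[b0 bM] [l Kl <-]] p0 q0 pq.
have pa : 0 <= p * a by exact: mulr_ge0.
have qb : 0 <= q * b by exact: mulr_ge0.
have sM : 0 <= p * a + q * b <= M.
  by rewrite addr_ge0//= -[leRHS]mul1r -pq mulrDl lerD// ler_wpM2l.
exists (p * a + q * b) => //.
have [s0|s0] := eqVneq (p * a + q * b) 0.
  (* the combination is 0, which is 0 times any element of K *)
  exists k => //; move/eqP: (s0); rewrite paddr_eq0// => /andP[/eqP pa0 /eqP qb0].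
  by rewrite s0 !scalerA pa0 qb0 !scale0r addr0.
exists ((p * a / (p * a + q * b)) *: k + (q * b / (p * a + q * b)) *: l).
  apply: cK => //.
  - by rewrite divr_ge0// addr_ge0.
  - by rewrite divr_ge0// addr_ge0.
  - by rewrite -mulrDl divff.
by rewrite scalerDr !scalerA ![(_ + _) * (_ / _)]mulrC !divfK.
Qed.

Lemma weakstar_compact_pointwise_bounded K :
  weakstar_compact K -> forall x, exists M : R, forall f, K f -> `|f x| <= M.
Proof.
move=> cK x.
have : compact ((fun f : weakstar E => (f : dual E) x : R^o) @` K).
  apply: (@continuous_compact (weakstar E) R^o) => //.
  by apply: continuous_subspaceT; exact: weakstar_eval_continuous.
move=> /compact_bounded[M [Mr /(_ (M + 1))]].
rewrite ltrDl ltr01 => /(_ isT) KM.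
by exists (M + 1) => f Kf; apply: KM; exists f.
Qed.

End weakstar_topology.

(** * Weak* compactness in the dual of a Banach space *)

Section weakstar_compactness.
Context {R : realType} {E : completeNormedModType R}.
Implicit Types (f g : dual E) (K S : set (dual E)).

Lemma pointwise_bounded_norm S :
  (forall x, exists M : R, forall f, S f -> `|f x| <= M) ->
  exists2 M : R, 0 <= M & forall f, S f -> `|f| <= M.
Proof.
move=> bS.
have [||M MS] := @Banach_Steinhauss R E R^o [set (f : E -> R^o) | f in S] _ _ 1.
- move=> _ [f Sf <-]; split; last exact: dual_linear.
  move=> r; exists (`|f| * r) => x xr.
  by rewrite (le_trans (dual_le_norm _ _))// ler_wpM2l.
- by move=> x; have [M MS] := bS x; exists M => _ [f Sf <-]; exact: MS.
exists (Num.max M 0); first by rewrite le_max lexx orbT.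
move=> f Sf; rewrite le_max; apply/orP; left.
by apply: dual_norm_le => x x1; apply: MS => //; exists f.
Qed.

Lemma weakstar_compact_norm_bounded K : weakstar_compact K ->
  exists2 M : R, 0 <= M & forall f, K f -> `|f| <= M.
Proof.
by move=> cK; exact/pointwise_bounded_norm/weakstar_compact_pointwise_bounded.
Qed.

(** Along an ultrafilter the values at each x lie in a compact interval, hence
converge; the pointwise limit is linear and inherits the norm bound, so it is
again a continuous functional.  Completeness of E is what makes pointwise
boundedness a sufficient hypothesis. *)
Lemma banach_alaoglu S : weakstar_closed S ->
  (forall x, exists M : R, forall f, S f -> `|f x| <= M) -> weakstar_compact S.
Proof.
move=> clS bS; have [M M0 MS] := pointwise_bounded_norm bS.
rewrite /weakstar_compact compact_ultra => F UF FS.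
have FF : ProperFilter F by exact: ultra_proper.
have lim x : exists l : R, (fun f : weakstar E => (f : dual E) x) @ F --> l.
  pose B : set R := `[- (M * `|x|), M * `|x|]%classic.
  have : compact B by exact: segment_compact.
  move=> /(_ ((fun f : weakstar E => (f : dual E) x) @ F) _)[|l [_ lF]].
    apply: (@filterS _ F _ S _ _ FS) => f Sf; rewrite /B /= in_itv/= -ler_norml.
    by apply: (le_trans (dual_le_norm _ _)); rewrite ler_wpM2r// MS.
  exists l => A nA.
  (* l is a cluster value and F is ultra, hence l is the limit *)
  have [//|nFA] :=
    in_ultra_setVsetC ((fun f : weakstar E => (f : dual E) x) @^-1` A) UF.
  have [|t [At]] := lF (~` A) A _ nA; first exact: nFA.
  by [].
pose g x : R^o := sval (cid (lim x)).
have gP x : (fun f : weakstar E => (f : dual E) x) @ F --> g x.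
  by rewrite /g; case: cid.
have gl : linear g.
  move=> a x y; apply: (cvg_unique (@Rhausdorff R) (gP (a *: x + y))).
  rewrite (_ : (fun f : weakstar E => (f : dual E) (a *: x + y)) =
      fun f : weakstar E => a * (f : dual E) x + (f : dual E) y).
    by apply: cvgD (gP y); apply: cvgM (gP x); exact: cvg_cst.
  by apply/funext => f; exact: (dual_linear f a x y).
have gM x : `|g x| <= M * `|x|.
  apply: (@closed_cvg _ R F _ (fun f : weakstar E => (f : dual E) x)
    [set t | `|t| <= M * `|x|] _ _ _ (gP x)).
    apply: (@closed_comp R R (fun t => `|t|) [set t | t <= M * `|x|]); last exact: closed_le.
    by move=> t _; exact: (@norm_continuous _ R^o).
  apply: (@filterS _ F _ S _ _ FS) => f Sf /=.
  by apply: (le_trans (dual_le_norm _ _)); rewrite ler_wpM2r// MS.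
have gc : continuous g.
  pose gL : {linear E -> R^o} := HB.pack g (GRing.isLinear.Build _ _ _ _ _ gl).
  apply: (@bounded_linear_continuous _ _ _ gL).
  apply/linear_boundedP; near=> r => x; rewrite (le_trans (gM x))//.
  by rewrite ler_wpM2r.
have gd : g \in @dual_pred R E by apply/asboolP.
exists (Dual gd : weakstar E).
have Fg : F --> (Dual gd : weakstar E).
  by apply/weakstar_cvgP => x; exact: gP.
split => //.
apply: (@closed_cvg _ (weakstar E) F _ id S clS _ _ Fg).
exact: FS.
Unshelve. all: by end_near. Qed.

End weakstar_compactness.

(** * Minimax over a convex set of functionals *)

Section minimax.
Context {R : realType} {E : normedModType R}.
Implicit Types (A K : set (dual E)) (c : dual E).

(** The alternative settles every finite subfamily of the inequalities, and the
compact slice at i0 passes to the whole family.  Only one slice is required to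
be compact, so A may be unbounded. *)
Lemma minimax_point A (I : choiceType) (X : set I) (x : I -> E) (v : I -> R) i0 :
  convex_set A -> X i0 ->
  weakstar_compact (A `&` [set a : dual E | v i0 <= a (x i0)]) ->
  (forall (s : seq I) (l : I -> R), uniq s -> {in s, forall i, X i} ->
    (forall i, 0 <= l i) -> \sum_(i <- s) l i = 1 ->
    exists2 a, A a & \sum_(i <- s) l i * v i < a (\sum_(i <- s) l i *: x i)) ->
  exists2 a, A a & forall i, X i -> v i <= a (x i).
Proof.
move=> cA Xi0 cK AX.
set K := A `&` _ in cK.
pose F i := K `&` [set a : dual E | v i <= a (x i)].
suff [a Fa] : \bigcap_(i in X) F i !=set0.
  by exists a => [|i Xi]; [have [[]] := Fa _ Xi0|have [_] := Fa _ Xi].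
move: cK; rewrite /weakstar_compact compact_In0 => /(_ I X F); apply.
  exists (fun i => [set a : dual E | v i <= a (x i)]) => // i _.
  exact: weakstar_closed_ge.
move=> D' D'X; pose s := undup (i0 :: enum_fset D').
have sX : {in s, forall i, X i}.
  by move=> i; rewrite mem_undup inE => /predU1P[->//|/D'X]; rewrite inE.
suff [a [Aa va]] : exists a, A a /\ forall i, i \in s -> 0 < a (x i) - v i.
  exists a => i /= iD'; split; first split => //=.
    by rewrite -subr_ge0 ltW// va// mem_undup inE eqxx.
  by rewrite /= -subr_ge0 ltW// va// mem_undup inE iD' orbT.
apply: contrapT => nva.
have [| | | |l [l0 l1 lA]] := @affine_alternative R (dual E) I
  (fun i a => a (x i) - v i) s A cA.
- move=> i a b p q pq; rewrite dualDE !dualZE -[v i in LHS]mul1r -pq; ring.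
- exact: undup_uniq.
- apply/eqP => s0; have : i0 \in s by rewrite mem_undup inE eqxx.
  by rewrite s0.
- move=> a Aa; apply: contrapT => na; apply: nva; exists a; split => // i si.
  by rewrite ltNge; apply/negP => ai; apply: na; exists i.
have [a Aa] := AX s l (undup_uniq _) sX l0 l1.
rewrite linear_sum/= ltNge => /negP; apply.
rewrite -subr_le0 -sumrB.
rewrite (eq_bigr (fun i => l i * (a (x i) - v i))) ?lA// => i _.
by rewrite linearZ/= mulrBr.
Qed.

(** If each k in K is beaten by c at some vector of X, with gain eta, then one
vector of X serves for all of K: otherwise every finite convex combination of
elements of X would fail for some k, and one k would fail them all. *)
Lemma minimax_direction K (X : set E) c (eta : R) :
  weakstar_compact K -> convex_set K -> X 0 -> 0 <= eta ->
  (forall (s : seq E) (l : E -> R), {in s, forall x, X x} ->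
    (forall i, 0 <= l i) -> \sum_(i <- s) l i = 1 ->
    X (\sum_(i <- s) l i *: i)) ->
  (forall k, K k -> exists2 x, X x & k x < c x - eta) ->
  exists2 x, X x & forall k, K k -> k x <= c x - eta.
Proof.
move=> cK cvK X0 eta0 cX KX; apply: contrapT => nX.
have [|s l _ sX l0 l1|k Kk kc] :=
  @minimax_point K E X id (fun x => c x - eta) 0 cvK X0.
- exact: weakstar_compact_slice.
- apply: contrapT => nK; apply: nX; exists (\sum_(x <- s) l x *: x).
    exact: cX.
  move=> k Kk; rewrite leNgt; apply/negP => ck; apply: nK; exists k => //.
  apply: le_lt_trans ck; rewrite linear_sum/=.
  rewrite (eq_bigr (fun i => l i * c i - l i * eta)) => [|i _]; last first.
    by rewrite mulrBr.
  rewrite sumrB -mulr_suml l1 mul1r lerB// le_eqVlt; apply/orP; left.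
  by apply/eqP/eq_bigr => i _; rewrite linearZ.
- have [x Xx] := KX k Kk.
  by rewrite ltNge kc.
Qed.

End minimax.

(** * Negative directions *)

Section negative_domain.
Context {R : realType} {E : completeNormedModType R}.
Implicit Types (D C K : set (dual E)) (c : dual E) (x y : E).

Lemma supremum_on_le D x (a : R) :
  (supremum_on D x <= a%:E)%E <-> forall d, D d -> d x <= a.
Proof.
split=> [Da d Dd|Da].
  by rewrite -lee_fin (le_trans _ Da)//; apply: ereal_sup_ubound; exists d.
by apply: ge_ereal_sup => _ [d Dd <-]; rewrite lee_fin Da.
Qed.

Lemma negative_domain0 x : negative_domain (set0 : set (dual E)) x <-> x != 0.
Proof.
by rewrite /negative_domain eqxx /=; split => [/eqP//|/eqP].
Qed.

Lemma negative_domainP D x : D !=set0 ->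
  negative_domain D x <-> exists2 a : R, 0 < a & forall d, D d -> d x <= - a.
Proof.
move=> D0; rewrite /negative_domain ifF; last by apply/negbTE/set0P.
split => [/= Dx|[a a0 Da] /=]; last first.
  apply: (@le_lt_trans _ _ (- a)%:E); last by rewrite lte_fin oppr_lt0.
  exact/supremum_on_le.
case: (supremum_on D x) (@supremum_on_le D x) Dx => [r| |] // Dx.
- rewrite lte_fin => r0; exists (- r); first by rewrite oppr_gt0.
  by rewrite opprK; apply/Dx.
- move=> _; exists 1 => //; apply/Dx; exact: leNye.
Qed.

Lemma negative_domain_lt0 D x d : negative_domain D x -> D d -> d x < 0.
Proof.
move=> Dx Dd; have D0 : D !=set0 by exists d.
move/(negative_domainP _ D0) : Dx => [a a0 Da].
by rewrite (le_lt_trans (Da _ Dd))// oppr_lt0.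
Qed.

(** The set of negative directions is open; only its openness along lines is
stated, since it is used to bound functionals pointwise. *)
Lemma negative_domain_shift D x y : weakstar_compact D ->
  negative_domain D x -> exists2 t : R, 0 < t & negative_domain D (x + t *: y).
Proof.
move=> cD; have [->|/set0P D0] := eqVneq D set0.
  move=> /negative_domain0 x0.
  have [xy|xy] := eqVneq (x + y) 0; last first.
    by exists 1 => //; rewrite scale1r; apply/negative_domain0.
  (* here y = - x, so that half a step along y leaves x / 2 *)
  exists 2^-1 => //; apply/negative_domain0.
  have yE : y = - x by rewrite -[y](addKr x) xy addr0.
  have -> : x + 2^-1 *: y = 2^-1 *: x.
    by rewrite yE scalerN -{1}(scale1r x) -scalerBl; congr (_ *: _); lra.
  by rewrite scaler_eq0 negb_or x0 andbT invr_eq0 pnatr_eq0.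
move=> /(negative_domainP _ D0)[a a0 Da].
have [M DM] := weakstar_compact_pointwise_bounded cD y.
have M0 : 0 <= M by case: D0 => d /DM; exact: le_trans.
exists (a / (2 * (M + 1))); first by rewrite divr_gt0// mulr_gt0//; lra.
apply/(negative_domainP _ D0); exists (a / 2); first lra.
move=> d Dd; rewrite dual_appD dual_appZ.
suff : a / (2 * (M + 1)) * d y <= a / 2 by have := Da d Dd; lra.
have dyM : d y <= M + 1 by have := DM d Dd; have := ler_norm (d y); lra.
rewrite invfM mulrA -[leRHS]mulr1 -mulrA ler_wpM2l//; first lra.
rewrite mulrC ler_pdivrMr ?mul1r//; lra.
Qed.

Lemma exists_negative_direction D : weakstar_compact D -> convex_set D ->
  ~ D 0 -> (exists e, forall d, D d -> d e <= -1).
Proof.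
move=> cD cvD nD0.
have [||||e _ De] := @minimax_direction R E D setT 0 1 cD cvD _ _ _ _ => //.
  move=> d Dd; apply: contrapT => nd; apply: nD0.
  suff <- : d = 0 by [].
  have dge x : -1 <= d x.
    by rewrite leNgt; apply/negP => dx; apply: nd; exists x => //; rewrite sub0r.
  apply/dualP => x /=.
  have [//|dx0] := eqVneq (d x) 0.
  (* the lower bound -1 fails at a suitable multiple of x *)
  have := dge (- (2 / d x) *: x); rewrite dual_appZ mulNr divfK//.
  lra.
by exists e => d /De; rewrite sub0r.
Qed.

(** For each y the support function of C is finite at x + t y for some t > 0, and
c (x) >= a then bounds c (y) from above; applied to y and - y this makes the
slice pointwise bounded. *)
Lemma weakstar_compact_upper_slice D C x (a : R) : weakstar_compact D ->
  weakstar_closed C ->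
  (forall y, negative_domain D y -> supremum_on C y \is a fin_num) ->
  negative_domain D x -> weakstar_compact (C `&` [set c : dual E | a <= c x]).
Proof.
move=> cD clC finC Dx.
apply: banach_alaoglu.
  by apply: (@closedI (weakstar E)) => //; exact: weakstar_closed_ge.
have ub y : exists M : R, forall c, C c /\ a <= c x -> c y <= M.
  have [t t0 Dt] := negative_domain_shift y cD Dx.
  have /fineK sE := finC _ Dt.
  exists ((fine (supremum_on C (x + t *: y)) - a) / t) => c [Cc ac].
  rewrite ler_pdivlMr//.
  have : c (x + t *: y) <= fine (supremum_on C (x + t *: y)).
    by apply: (@supremum_on_le C _ _).1 => //; rewrite sE.
  by rewrite dual_appD dual_appZ [t * _]mulrC; lra.
move=> y; have [M CM] := ub y; have [N CN] := ub (- y).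
exists (Num.max M N) => c Cc; rewrite ler_norml; apply/andP; split.
  by rewrite lerNl le_max -dual_appN CN ?orbT.
by rewrite le_max CM.
Qed.

End negative_domain.

(** * Sequences of negative directions and their limsups *)

Section boundary_conditions.
Context {R : realType} {E : completeNormedModType R}.
Implicit Types (D C B K : set (dual E)) (c : dual E) (x y : nat -> E).

Lemma limn_esup_le (u : nat -> \bar R) a N :
  (forall n, (N <= n)%N -> (u n <= a)%E) -> (limn_esup u <= a)%E.
Proof.
move=> ua; apply: (@le_trans _ _ (ereal_sup (u @` [set n | (N <= n)%N]))).
  by apply: ereal_inf_lbound; exists [set n | (N <= n)%N] => //; exists N.
by apply: ge_ereal_sup => _ [n Nn <-]; exact: ua.
Qed.

Lemma limn_esup_lt (u : nat -> \bar R) a :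
  (limn_esup u < a)%E -> exists N, forall n, (N <= n)%N -> (u n <= a)%E.
Proof.
move=> /ereal_inf_lt[_ [V [N _ NV] <-] Va]; exists N => n Nn.
rewrite (le_trans _ (ltW Va))//.
by apply: ereal_sup_ubound; exists n => //; exact: NV.
Qed.

Lemma limn_esup_ge (u : nat -> \bar R) a :
  (forall n, (a <= u n)%E) -> (a <= limn_esup u)%E.
Proof.
move=> au; apply: le_ereal_inf_tmp => _ [V [N _ NV] <-].
rewrite (le_trans (au N))//.
by apply: ereal_sup_ubound; exists N => //; apply: NV => /=.
Qed.

Lemma ereal_between (a b : \bar R) : (a < b)%E ->
  exists2 r : R, (a < r%:E)%E & (r%:E < b)%E.
Proof.
case: a b => [a| |] [b| |] //= ab.
- by move: ab; rewrite lte_fin => ab; exists ((a + b) / 2); rewrite lte_fin; lra.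
- by exists (a + 1); rewrite ?ltry// lte_fin ltrDl.
- by exists (b - 1); rewrite ?ltNyr// lte_fin gtrBl.
- by exists 0; rewrite ?ltNyr ?ltry.
Qed.

Lemma sum_eventually (V : zmodType) (F : nat -> V) (t : seq nat) : uniq t ->
  exists N, forall n, (N <= n)%N ->
    \sum_(0 <= k < n) (if k \in t then F k else 0) = \sum_(k <- t) F k.
Proof.
move=> ut; exists (\max_(k <- t) k).+1 => n tn.
rewrite -big_mkcond -big_filter; apply: perm_big; apply: uniq_perm => //.
  by rewrite filter_uniq// iota_uniq.
move=> k; rewrite mem_filter mem_index_iota/=.
have [kt|//] := boolP (k \in t).
rewrite (leq_ltn_trans _ tn)//; exact: leq_bigmax_seq.
Qed.

Lemma sigma_convex_hull_sum (x : nat -> E) (t : seq nat) (l : nat -> R) :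
  uniq t -> (forall i, 0 <= l i) -> \sum_(i <- t) l i = 1 ->
  sigma_convex_hull x (\sum_(i <- t) l i *: x i).
Proof.
move=> ut l0 l1; exists (fun n => if n \in t then l n else 0); split.
- by move=> n; case: ifP.
- have [N tN] := sum_eventually l ut.
  rewrite -l1; apply: cvg_near_cst; exists N => // n Nn; exact: tN.
- have [N tN] := sum_eventually (fun i => l i *: x i) ut.
  apply: cvg_near_cst; exists N => // n Nn; rewrite /= -(tN n Nn).
  by apply: eq_bigr => k _; case: ifP => //; rewrite scale0r.
Qed.

Lemma closure_dualP (S : set (dual E)) c :
  closure S c <-> forall e : R, 0 < e -> exists2 s, S s & `|c - s| < e.
Proof.
split=> [Sc e e0|Sc A /nbhs_ballP[e /= e0 eA]].
  have [|s [Ss cs]] := Sc (ball c e); first exact: nbhsx_ballx.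
  by exists s => //; move: cs; rewrite -ball_normE.
have [s Ss cs] := Sc e e0; exists s; split => //; apply: eA.
by rewrite -ball_normE.
Qed.

Lemma bounded_seqP (x : nat -> E) :
  bounded_fun x <-> exists2 M : R, 0 <= M & forall n, `|x n| <= M.
Proof.
split=> [[M [Mr xM]]|[M M0 xM]].
  exists (`|M| + 1) => [|n]; first by rewrite addr_ge0.
  by apply: xM => //; rewrite (le_lt_trans (ler_norm M))// ltrDl ltr01.
exists M; split; first exact: ger0_real.
by move=> N MN n _ /=; rewrite (le_trans (xM n))// ltW.
Qed.

(** Testing the covering property on the sets K n of functionals of norm at most n
that are bounded by al on the tail of x from n on. *)
Lemma limsup_sup_eq D C B :
  weakstar_closed C -> convex_set C -> B `<=` C ->
  (forall K : nat -> set (dual E),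
      (forall n, K n `<=` K n.+1) ->
      (forall n, [/\ weakstar_compact (K n), convex_set (K n) & K n `<=` C]) ->
      B `<=` \bigcup_n K n ->
      C `<=` closure (set_add (\bigcup_n K n) (generated_cone D))) ->
  forall x : nat -> E, bounded_fun x ->
      (forall n, negative_domain D (x n)) ->
      ereal_sup [set limn_esup (fun n => (b (x n))%:E) | b in B] =
      ereal_sup [set limn_esup (fun n => (c (x n))%:E) | c in C].
Proof.
move=> clC cvC BC DC x /bounded_seqP[M M0 xM] Dx.
apply/eqP; rewrite eq_le; apply/andP; split.
  by apply: ereal_sup_le => _ [b Bb <-]; exists b => //; exact: BC.
rewrite leNgt; apply/negP => /ereal_sup_gt[_ [c Cc <-]].
set s := ereal_sup _ => sc.
have [al sal alc] := ereal_between sc.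
pose K n := C `&` [set f : dual E | `|f| <= n%:R] `&`
  [set f : dual E | forall m, (n <= m)%N -> f (x m) <= al].
have CK : C `<=` closure (set_add (\bigcup_n K n) (generated_cone D)).
  apply: DC.
  - move=> n f [[Cf fn] fx]; split; first split => //.
      by rewrite /= (le_trans fn)// ler_nat.
    by move=> m nm; apply: fx; exact: ltnW.
  - move=> n; split.
    + apply: banach_alaoglu; last first.
        move=> z; exists (n%:R * `|z|) => f [[_ /= fn] _].
        by rewrite (le_trans (dual_le_norm _ _))// ler_wpM2r.
      (* the norm ball is an intersection of weak* closed half-spaces *)
      have -> : K n = C `&` (\bigcap_(z in [set z : E | `|z| <= 1])
            ([set f : dual E | f z <= n%:R] `&` [set f : dual E | - n%:R <= f z]))
          `&` \bigcap_(m in [set m | (n <= m)%N]) [set f : dual E | f (x m) <= al].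
        apply/seteqP; split=> f [[Cf fn] fx].
          split; last by move=> m; exact: fx.
          split => // z z1 /=.
          have : `|f z| <= n%:R.
            rewrite (le_trans (dual_le_norm _ _))// -[leRHS]mulr1.
            by rewrite ler_pM.
          by rewrite ler_norml => /andP[].
        split; last by move=> m; exact: fx.
        split => //; apply: dual_norm_le => z z1.
        by have [/= ? ?] := fn z z1; rewrite ler_norml; apply/andP.
      apply: (@closedI (weakstar E)); first apply: (@closedI (weakstar E)) => //.
        apply: (@closed_bigI (weakstar E)) => z _.
        apply: (@closedI (weakstar E)). exact: weakstar_closed_le.
        exact: weakstar_closed_ge.
      apply: (@closed_bigI (weakstar E)) => m _; exact: weakstar_closed_le.
    + apply/convex_setP => f g p q [[Cf /= fn] /= fx] [[Cg /= gn] /= gx] p0 q0 pq.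
      split; first split.
      * by move/convex_setP : cvC; exact.
      * rewrite /= (le_trans (ler_normD _ _))// !normrZ !ger0_norm//.
        by rewrite -[leRHS]mul1r -{1}pq mulrDl lerD// ler_wpM2l.
      * move=> m nm; rewrite dualDE !dualZE -[leRHS]mul1r -pq mulrDl.
        by rewrite lerD// ler_wpM2l// ?fx ?gx.
    + by move=> f [[]].
  - move=> b Bb.
    have [|N bN] := @limn_esup_lt (fun n => (b (x n))%:E) al%:E.
      by rewrite (le_lt_trans _ sal)//; apply: ereal_sup_ubound; exists b.
    exists (maxn N (Num.truncn `|b|).+1) => //; split; first split.
    + exact: BC.
    + rewrite /= (le_trans (ltW (truncnS_gt _)))// ler_nat leq_maxr//.
    + by move=> m nm; rewrite -lee_fin bN// (leq_trans _ nm)// leq_maxl.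
have : (limn_esup (fun n => (c (x n))%:E) <= al%:E)%E; last by rewrite leNgt alc.
apply/lee_addgt0Pr => e e0.
have [|s' [k [n _ [[Ck kn] kx]] [d Dd <-]] cs'] :=
  (closure_dualP _ _).1 (CK c Cc) (e / (M + 1)).
  by rewrite divr_gt0//; lra.
apply: (@limn_esup_le _ _ n) => m nm.
rewrite -EFinD lee_fin.
have dx : d (x m) <= 0.
  case: Dd => [->//|[l l0 [d' Dd' <-]]].
  by rewrite dualZE mulr_ge0_le0// ltW// (negative_domain_lt0 (Dx m)).
have : (c - (k + d)) (x m) <= e.
  apply: (le_trans (ler_norm _)); apply: (le_trans (dual_le_norm _ _)).
  apply: (@le_trans _ _ (e / (M + 1) * (M + 1))).
    by rewrite ler_pM// ?ltW//; have := xM m; lra.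
  by rewrite divfK//; lra.
rewrite dualBE dualDE.
have := kx m nm; lra.
Qed.

(** For al below the infimum, minimax produces one c in C with c (x n) >= al for
every n, which is much more than a limsup that is at least al. *)
Lemma inf_sup_le_limsup D C :
  weakstar_compact D -> weakstar_closed C -> convex_set C ->
  (forall y : E, negative_domain D y -> supremum_on C y \is a fin_num) ->
  forall x : nat -> E, (forall n, negative_domain D (x n)) ->
  (ereal_inf [set supremum_on C y | y in sigma_convex_hull x] <=
   ereal_sup [set limn_esup (fun n => (c (x n))%:E) | c in C])%E.
Proof.
move=> cD clC cvC finC x Dx.
rewrite leNgt; apply/negP; set s := ereal_sup _ => sC.
have [al sal alC] := ereal_between sC.
have [||c Cc cx] :=
  @minimax_point R E C nat setT x (fun=> al) 0%N cvC I _ _.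
- exact: (weakstar_compact_upper_slice cD clC finC (Dx 0%N)).
- move=> t l ut _ l0 l1; rewrite -mulr_suml l1 mul1r.
  set y := \sum_(i <- t) l i *: x i; apply: contrapT => nC.
  have : (supremum_on C y <= al%:E)%E.
    apply/supremum_on_le => c Cc; rewrite leNgt; apply/negP => alc.
    by apply: nC; exists c.
  rewrite leNgt => /negP; apply; apply: lt_le_trans alC _.
  apply: ereal_inf_lbound; exists y => //.
  exact: sigma_convex_hull_sum.
have : (al%:E <= s)%E; last by rewrite leNgt sal.
apply: (@le_trans _ _ (limn_esup (fun n => (c (x n))%:E))).
  by apply: limn_esup_ge => n; rewrite lee_fin cx.
by apply: ereal_sup_ubound; exists c.
Qed.

End boundary_conditions.

(** * Separating sequences *)

Section separating_sequence.
Context {R : realType} {E : completeNormedModType R}.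
Implicit Types (D C B K : set (dual E)) (c : dual E).

(** A set at norm distance at least delta from c is separated from c by a vector
of the unit ball of E itself: k is beaten at some vector of the ball because
the norm of c - k is a supremum over that ball, and minimax makes the vector
independent of k. *)
Lemma unit_ball_direction K c (delta : R) :
  weakstar_compact K -> convex_set K -> 0 < delta ->
  (forall k, K k -> delta <= `|c - k|) ->
  exists2 x : E, `|x| <= 1 & forall k, K k -> k x <= c x - delta / 2.
Proof.
move=> cK cvK d0 cKd; apply: (minimax_direction cK cvK).
- by rewrite /= normr0.
- lra.
- move=> s l s1 l0 l1.
  rewrite /= (le_trans (ler_norm_sum _ _ _))// -l1 big_seq [leRHS]big_seq.
  apply: ler_sum => i si; rewrite normrZ ger0_norm// -[leRHS]mulr1.
  by rewrite ler_wpM2l// s1.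
- move=> k Kk; apply: contrapT => nk.
  have : `|c - k| <= delta / 2.
    apply: dual_norm_le => x x1; rewrite ler_norml dualBE; apply/andP; split.
      rewrite leNgt; apply/negP => xk; apply: nk; exists (- x).
        by rewrite /= normrN.
      by rewrite !dual_appN; lra.
    rewrite leNgt; apply/negP => xk; apply: nk; exists x => //.
    lra.
  have := cKd k Kk; lra.
Qed.

(** For D nonempty, apply the previous lemma to K plus the cone of D truncated at
a level m so high that m d (x) <= |c| + M, where M bounds K, forces d (x) <= eta / 2 on
D.  Since d (e) <= -1 on D, the vector x + eta e is a negative direction. *)
Lemma separating_direction D K c (delta : R) :
  weakstar_compact D -> convex_set D -> ~ D 0 ->
  (exists z : E, z != 0) ->
  weakstar_compact K -> convex_set K -> 0 < delta ->
  (forall s, set_add K (generated_cone D) s -> delta <= `|c - s|) ->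
  exists y : E, [/\ `|y| <= 2, negative_domain D y &
    forall k, K k -> k y <= c y - delta / 4].
Proof.
move=> cD cvD nD0 [z z0] cK cvK d0 cKD.
have [DE|/set0P D0] := eqVneq D set0.
  have [KE|/set0P[k0 Kk0]] := eqVneq K set0.
    exists (`|z|^-1 *: z); split.
    - by rewrite normrZ normfV normr_id mulVf ?normr_eq0// ler1n.
    - rewrite DE; apply/negative_domain0.
      by rewrite scaler_eq0 invr_eq0 normr_eq0 orbb.
    - by rewrite KE.
  have [k Kk|x x1 Kx] := unit_ball_direction cK cvK d0 (c := c).
    by apply: cKD; exists k => //; exists 0; [left|rewrite addr0].
  exists x; split.
  - lra.
  - rewrite DE; apply/negative_domain0/eqP => xE.
    have := Kx _ Kk0; rewrite xE !linear0; lra.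
  - by move=> k /Kx; lra.
have [e De] := exists_negative_direction cD cvD nD0.
have [M M0 KM] := weakstar_compact_norm_bounded cK.
pose b := `|c| + M.
have b0 : 0 <= b by rewrite addr_ge0.
(* eta is small enough for x + eta e to have norm at most 2 and for eta e to
   change k - c by at most delta / 4. *)
pose eta := delta / (4 * (1 + `|e|) * (1 + b + delta)).
have e0 : 0 <= `|e| by [].
have eta0 : 0 < eta by rewrite divr_gt0// !mulr_gt0//; lra.
have etaE : eta * (4 * (1 + `|e|) * (1 + b + delta)) = delta.
  by rewrite divfK// gt_eqF// !mulr_gt0//; lra.
have p0 : 0 <= eta * `|e| by rewrite mulr_ge0// ltW.
have pb0 : 0 <= eta * `|e| * b by rewrite mulr_ge0.
have eg0 : 0 <= eta * (1 + b + delta) by rewrite mulr_ge0// ?ltW//; lra.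
have deltaE : delta = 4 * (eta * (1 + b + delta) +
    (eta * `|e| + eta * `|e| * b + eta * `|e| * delta)) by rewrite -{1}etaE; ring.
have etab : eta * `|e| * b <= delta / 4.
  have : 0 <= eta * `|e| * delta by rewrite mulr_ge0// ltW.
  lra.
have eta1 : eta * `|e| <= 1.
  rewrite leNgt; apply/negP => p1.
  have : 1 * delta <= eta * `|e| * delta by rewrite ler_wpM2r// ltW.
  lra.
pose m := (b + 1) / (eta / 2).
have m0 : 0 < m by rewrite divr_gt0//; lra.
have mE : m * (eta / 2) = b + 1 by rewrite divfK// gt_eqF//; lra.
have [_ [k Kk [_ [a /= /andP[a0 am] [d Dd <-]] <-]]|x x1 Kx] :=
  unit_ball_direction
    (weakstar_compact_add cK (weakstar_compact_truncated_cone (M := m) cD))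
    (convex_set_add cvK (convex_truncated_cone (M := m) cvD)) d0 (c := c).
  apply: cKD; exists k => //; exists (a *: d) => //.
  move: a0; rewrite le_eqVlt => /predU1P[<-|a0]; first by left; rewrite scale0r.
  by right; exists a => //; exists d.
have Kxd k d (a : R) : K k -> D d -> 0 <= a -> a <= m ->
    k x + a * d x <= c x - delta / 2.
  move=> Kk Dd a0 am; rewrite -dualZE -dualDE; apply: Kx.
  by exists k => //; exists (a *: d) => //; exists a => /=; [rewrite a0|exists d].
have fx (f : dual E) : `|f x| <= `|f|.
  by apply: (le_trans (dual_le_norm _ _)); rewrite -[leRHS]mulr1 ler_wpM2l.
have [KE|/set0P[k0 Kk0]] := eqVneq K set0.
  exists (eta *: e); split.
  - by rewrite normrZ gtr0_norm//; lra.
  - apply/(negative_domainP _ D0); exists eta => // d Dd.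
    by rewrite dual_appZ -[leRHS]mulr1 mulNr -mulrN ler_wpM2l ?De// ltW.
  - by rewrite KE.
exists (x + eta *: e); split.
- rewrite (le_trans (ler_normD _ _))// normrZ gtr0_norm//; lra.
- apply/(negative_domainP _ D0); exists (eta / 2); first lra.
  move=> d Dd; rewrite dual_appD dual_appZ.
  have dx : m * d x <= b.
    have := Kxd k0 d m Kk0 Dd (ltW m0) (lexx _).
    have := fx c; have := fx k0; have := KM _ Kk0.
    rewrite !ler_norml /b => ? /andP[? ?] /andP[? ?]; lra.
  have dx' : d x <= eta / 2.
    rewrite leNgt; apply/negP => ed.
    have : m * (eta / 2) <= m * d x by rewrite ler_wpM2l// ltW.
    rewrite mE; lra.
  have : eta * d e <= eta * -1 by rewrite ler_wpM2l ?De// ltW.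
  lra.
- move=> k Kk; rewrite !dual_appD !dual_appZ.
  have [d1 Dd1] := D0.
  have := Kxd k d1 0 Kk Dd1 (lexx _) (ltW m0); rewrite mul0r addr0.
  have fe (f : dual E) : `|f e| <= `|f| * `|e| by exact: dual_le_norm.
  have : k e - c e <= b * `|e|.
    have := fe k; have := fe c.
    have : `|k| * `|e| <= M * `|e| by rewrite ler_wpM2r// KM.
    rewrite /b mulrDl !ler_norml => ? /andP[? ?] /andP[? ?]; lra.
  move=> /(ler_wpM2l (ltW eta0)); rewrite mulrBr.
  lra.
Qed.

Lemma hull_app_ge c (x : nat -> E) (m : R) y :
  (forall n, m <= c (x n)) -> sigma_convex_hull x y -> m <= c y.
Proof.
move=> cx [l [l0 l1 ly]].
have ml : (fun n => m * series l n) @ \oo --> m * 1.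
  by apply: cvgM; [exact: cvg_cst|exact: l1].
have cl : (fun n => c (series (fun n => l n *: x n) n) : R) @ \oo --> (c y : R).
  exact: (continuous_cvg _ (@dual_continuous _ _ c y) ly).
rewrite -[m]mulr1; apply: (ler_cvg_to ml cl).
apply: nearW => n; rewrite /series/= linear_sum mulr_sumr.
  apply: ler_sum => i _; apply: (@le_trans _ _ (l i * c (x i))).
  by rewrite mulrC ler_wpM2l.
by rewrite linearZ.
Qed.

Lemma increasing_seq_ge (f : nat -> nat) :
  increasing_seq f -> forall n, (n <= f n)%N.
Proof.
move=> inc; elim=> // n IH; apply: (leq_ltn_trans IH).
have fn : (f n.+1 <= f n)%N = false by rewrite -[RHS](ltnn n); exact: inc.
by rewrite ltnNge fn.
Qed.

(** A point c of C outside the closure yields a sequence of negative directions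
on which c exceeds K n by delta / 4; a subsequence makes the values of c converge,
so that c bounds the support function of C from below on the whole hull. *)
Lemma subset_closure_cone D C B :
  weakstar_compact D -> convex_set D -> ~ D 0 ->
  (exists z : E, z != 0) ->
  (forall x : nat -> E, bounded_fun x ->
      (forall n, negative_domain D (x n)) ->
      (ereal_inf [set supremum_on C y | y in sigma_convex_hull x] <=
       ereal_sup [set limn_esup (fun n => (b (x n))%:E) | b in B])%E) ->
  forall K : nat -> set (dual E),
      (forall n, K n `<=` K n.+1) ->
      (forall n, [/\ weakstar_compact (K n), convex_set (K n) & K n `<=` C]) ->
      B `<=` \bigcup_n K n ->
      C `<=` closure (set_add (\bigcup_n K n) (generated_cone D)).
Proof.
move=> cD cvD nD0 nzE Csup K Kincr KP BK c Cc; apply: contrapT => /closure_dualP nc.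
have [delta d0 cd] : exists2 delta : R, 0 < delta & forall s,
    set_add (\bigcup_n K n) (generated_cone D) s -> delta <= `|c - s|.
  apply: contrapT => nd; apply: nc => e e0; apply: contrapT => ne; apply: nd.
  by exists e => // s Ss; rewrite leNgt; apply/negP => se; apply: ne; exists s.
have /choice[y yP] : forall n, exists y : E, [/\ `|y| <= 2, negative_domain D y &
    forall k, K n k -> k y <= c y - delta / 4].
  move=> n.
  have [cK cvK _] := KP n.
  apply: separating_direction => // s [k Kk [d Dd <-]].
  by apply: cd; exists k; [exists n|exists d].
have cy : bounded_fun (fun n => c (y n) : R).
  exists (`|c| * 2); split; first exact: num_real.
  move=> N cN n _ /=; rewrite (le_trans _ (ltW cN))//.
  apply: (le_trans (dual_le_norm _ _)).
  by rewrite ler_wpM2l//; have [] := yP n.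
have [f fincr /cvg_ex[t ct]] := bolzano_weierstrass cy.
have d16 : 0 < delta / 16 by lra.
have [N _ Nt] : \forall n \near \oo, `|t - c (y (f n))| < delta / 16.
  by move/cvgrPdist_lt : ct; exact.
pose x n := y (f (n + N)%N).
have xt n : t - delta / 16 <= c (x n) <= t + delta / 16.
  have := Nt (n + N)%N (leq_addl _ _); rewrite ltr_norml /x.
  by move=> /andP[? ?]; apply/andP; split; lra.
have Kmono n m : (n <= m)%N -> K n `<=` K m.
  move=> /subnK <-; elim: (m - n)%N => // j IH; rewrite addSn.
  exact: (subset_trans IH).
have : (ereal_inf [set supremum_on C y | y in sigma_convex_hull x] <=
        (t + delta / 16 - delta / 4)%:E)%E.
  apply: (le_trans (Csup x _ _)).
  - by apply/bounded_seqP; exists 2 => // n; have [] := yP (f (n + N)%N).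
  - by move=> n; have [] := yP (f (n + N)%N).
  apply: ge_ereal_sup => _ [b Bb <-].
  have [n0 _ Kb] := BK b Bb.
  apply: (@limn_esup_le R _ _ n0) => n n0n; rewrite lee_fin.
  have [_ _ /(_ b)] := yP (f (n + N)%N).
  have /Kmono/(_ b Kb) Kfb : (n0 <= f (n + N))%N.
    rewrite (leq_trans n0n)// (leq_trans _ (increasing_seq_ge fincr _))//.
    exact: leq_addr.
  move=> /(_ Kfb); have /andP[_] := xt n; rewrite /x; lra.
apply/negP; rewrite -ltNge.
apply: (@lt_le_trans _ _ (t - delta / 16)%:E); first by rewrite lte_fin; lra.
apply: le_ereal_inf_tmp => _ [z xz <-].
apply: (@le_trans _ _ (c z)%:E); last by apply: ereal_sup_ubound; exists c.
rewrite lee_fin; apply: hull_app_ge xz => n.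
by have /andP[] := xt n.
Qed.

End separating_sequence.

(** * The equivalence *)

Theorem proposition7 (R : realType) (E : completeNormedModType R)
    (D C B : set (dual E)) :
  weakstar_compact D -> convex_set D -> ~ D 0 ->
  weakstar_closed C -> convex_set C ->
  (forall x, negative_domain D x -> supremum_on C x \is a fin_num) ->
  B `<=` C ->
  (* rules out only E = {0} with B empty, where (ii) and (iii) hold vacuously *)
  (exists x : E, x != 0) \/ B !=set0 ->
  [<-> (* (i) *)
    forall K : nat -> set (dual E),
      (forall n, K n `<=` K n.+1) ->
      (forall n, [/\ weakstar_compact (K n), convex_set (K n) & K n `<=` C]) ->
      B `<=` \bigcup_n K n ->
      C `<=` closure (set_add (\bigcup_n K n) (generated_cone D));
    (* (ii) *)
    forall x : nat -> E, bounded_fun x ->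
      (forall n, negative_domain D (x n)) ->
      ereal_sup [set limn_esup (fun n => (b (x n))%:E) | b in B] =
      ereal_sup [set limn_esup (fun n => (c (x n))%:E) | c in C];
    (* (iii) *)
    forall x : nat -> E, bounded_fun x ->
      (forall n, negative_domain D (x n)) ->
      (ereal_inf [set supremum_on C y | y in sigma_convex_hull x] <=
       ereal_sup [set limn_esup (fun n => (b (x n))%:E) | b in B])%E
  ].
Proof.
move=> cD cvD nD0 clC cvC finC BC nondeg; tfae.
- exact: (limsup_sup_eq clC cvC BC).
- move=> BC_eq x bx Dx; rewrite (BC_eq x bx Dx).
  exact: (inf_sup_le_limsup cD clC cvC finC Dx).
- have [nzE|zE] := pselect (exists z : E, z != 0).
    exact: (subset_closure_cone cD cvD nD0 nzE).
  (* E is the zero space: its dual is a point, which some K n contains *)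
  move=> _ K _ _ BK c _.
  have E0 (f : dual E) : f = 0.
    apply/dualP => x; suff -> : x = 0 by rewrite linear0.
    by apply: contrapT => /eqP x0; apply: zE; exists x.
  case: nondeg => [/zE//|[b /BK[n _ Kb]]].
  apply: subset_closure; exists b; first by exists n.
  by exists 0; [left|rewrite [RHS]E0 [LHS]E0].
Qed.
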